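(* There exist a complex Banach space $X$ and an operator $T\in B(X)$ which is Kreiss bounded and $2$-Ritt, such that for every integer $k\ge0$ there is a constant $C>1$ (depending only on $k$) with $$\frac1C\, n^{\frac{1-k}{2}}\le\|T^n(I-T)^k\|\le C\, n^{\frac{1-k}{2}}\qquad\text{for all } n\ge1.$$
   Context: $\mathbb{D}$ is the open unit disk; $R(\lambda,T)=(\lambda I-T)^{-1}$. $T$ is Kreiss bounded if $\sigma(T)\subset\overline{\mathbb{D}}$ and there is $C>0$ with $\|R(\lambda,T)\|\le\frac{C}{|\lambda|-1}$ for all $|\lambda|>1$. $T$ is $2$-Ritt if $\sigma(T)\subset\overline{\mathbb{D}}$ and there is $C>0$ with $\|R(\lambda,T)\|\le\frac{C}{|\lambda-1|^{2}}$ for all $1<|\lambda|<2$. *)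

(* Defs.v *)
(* Stdlib reals with Coquelicot.  Complex Banach spaces are
   [CompleteNormedModule C_AbsRing] (the norm is real valued), and an element
   of B(X) is a map [T : X -> X] with [is_linear T]: Coquelicot's [is_linear]
   includes boundedness. *)
From Stdlib Require Import Reals ClassicalEpsilon.
From Coquelicot Require Import Coquelicot.

Open Scope R_scope.

Section Operators.

Context {X : CompleteNormedModule C_AbsRing}.

(* [real] sends an infinite supremum to 0, so this is the operator norm only
   for bounded operators. *)
Definition op_norm (A : X -> X) : R :=
  real (Lub_Rbar (fun r : R => exists x : X, norm x <= 1 /\ r = norm (A x))).

(* lambda I - T *)
Definition scalar_minus (lambda : C) (T : X -> X) : X -> X :=
  fun x => minus (scal lambda x) (T x).

Definition is_inverse (A S : X -> X) : Prop :=
  is_linear S /\ (forall x, S (A x) = x) /\ (forall x, A (S x) = x).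

Definition spectrum (T : X -> X) (lambda : C) : Prop :=
  ~ exists S : X -> X, is_inverse (scalar_minus lambda T) S.

(* Off the spectrum this is the unique inverse of lambda I - T in B(X); on the
   spectrum its value is unspecified. *)
Definition resolvent (lambda : C) (T : X -> X) : X -> X :=
  epsilon (inhabits (fun x : X => x)) (is_inverse (scalar_minus lambda T)).

Definition kreiss_bounded (T : X -> X) : Prop :=
  (forall lambda : C, spectrum T lambda -> Cmod lambda <= 1) /\
  exists K : R, 0 < K /\
    forall lambda : C, 1 < Cmod lambda ->
      op_norm (resolvent lambda T) <= K / (Cmod lambda - 1).

Definition two_Ritt (T : X -> X) : Prop :=
  (forall lambda : C, spectrum T lambda -> Cmod lambda <= 1) /\
  exists K : R, 0 < K /\
    forall lambda : C, 1 < Cmod lambda < 2 ->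
      op_norm (resolvent lambda T) <= K / Cmod (lambda - 1)%C ^ 2.

Definition op_pow (T : X -> X) (n : nat) : X -> X := fun x => Nat.iter n T x.

Definition op_comp (A B : X -> X) : X -> X := fun x => A (B x).

Definition id_minus (T : X -> X) : X -> X := fun x => minus x (T x).

End Operators.

(* Main.v *)
(** On the Banach algebra [bv] of sequences of bounded variation, multiplication
    by [m] has norm between [||m||] and [2 ||m||].  Take [T] to be multiplication
    by [lam j = j / (j + i)], a sequence on the circle with diameter [0, 1] that
    tends to 1.

    The increments of [1 / (z - lam)] have modulus
    [1 / (|z - 1|^2 |j + w| |j + 1 + w|)] with [w = i z / (z - 1)], and
    [Im w / (|j + w| |j + 1 + w|)] is the sine of the angle under which the segment
    from [j] to [j + 1] is seen from [-w].  These angles add up to at most [PI], so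
    the variation is at most [PI / (|z|^2 - Re z)], which gives both resolvent
    conditions.

    Since [|lam j| ^ 2 = 1 - |1 - lam j| ^ 2], the increments of
    [lam ^ n (1 - lam) ^ k] are [O(n ^ (1 - k / 2) / (j ^ 2 + n))], whose sum is
    [O(n ^ ((1 - k) / 2))].  Conversely, for [j] between [sqrt (n + k)] and twice
    that, this sequence has modulus of order [n ^ (- k / 2)] and each step turns its
    argument by an angle of order 1. *)
Require Import Defs.
From Stdlib Require Import Reals Lra Lia ClassicalEpsilon.
From Stdlib Require Import FunctionalExtensionality PropExtensionality ProofIrrelevance.
From Coquelicot Require Import Coquelicot.
Open Scope R_scope.

(** * The Banach algebra of sequences of bounded variation *)

Fixpoint partial_var (f : nat -> C) (N : nat) : R :=
  match N with
  | O => Cmod (f O)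
  | S N => partial_var f N + Cmod (f (S N) - f N)%C
  end.

Lemma partial_var_ge_0 (f : nat -> C) (N : nat) : 0 <= partial_var f N.
Proof.
  induction N as [|N IH]; simpl; [apply Cmod_ge_0|].
  assert (H := Cmod_ge_0 (f (S N) - f N)%C); lra.
Qed.

Lemma Cmod_le_partial_var (f : nat -> C) (N : nat) : Cmod (f N) <= partial_var f N.
Proof.
  induction N as [|N IH]; simpl; [lra|].
  replace (f (S N)) with (f N + (f (S N) - f N))%C at 1 by ring.
  eapply Rle_trans; [apply Cmod_triangle|lra].
Qed.

Lemma partial_var_plus (f g : nat -> C) (N : nat) :
  partial_var (fun j => f j + g j)%C N <= partial_var f N + partial_var g N.
Proof.
  induction N as [|N IH]; simpl; [apply Cmod_triangle|].
  assert (H := Cmod_triangle (f (S N) - f N) (g (S N) - g N)).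
  replace (f (S N) + g (S N) - (f N + g N))%C
    with (f (S N) - f N + (g (S N) - g N))%C by ring.
  lra.
Qed.

Lemma partial_var_scal (c : C) (f : nat -> C) (N : nat) :
  partial_var (fun j => c * f j)%C N = Cmod c * partial_var f N.
Proof.
  induction N as [|N IH]; simpl; [apply Cmod_mult|].
  replace (c * f (S N) - c * f N)%C with (c * (f (S N) - f N))%C by ring.
  rewrite Cmod_mult, IH; ring.
Qed.

Lemma partial_var_ext (f g : nat -> C) (N : nat) :
  (forall j, f j = g j) -> partial_var f N = partial_var g N.
Proof. intros H; f_equal; apply functional_extensionality, H. Qed.

Lemma partial_var_mult (f g : nat -> C) (N : nat) :
  partial_var (fun j => f j * g j)%C N <= 2 * partial_var f N * partial_var g N.
Proof.
  (* The subtracted product is what the induction carries. The new increment of [f * g] and the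
     growth of the product of the moduli are both at most [a * q' + p * b], which accounts for the
     factor 2. *)
  enough (H : partial_var (fun j => f j * g j)%C N <= 2 * partial_var f N * partial_var g N
    - Cmod (f N) * Cmod (g N)).
  { assert (H1 := Cmod_ge_0 (f N)); assert (H2 := Cmod_ge_0 (g N)); nra. }
  induction N as [|N IH]; simpl.
  - rewrite Cmod_mult; lra.
  - replace (f (S N) * g (S N) - f N * g N)%C
      with ((f (S N) - f N) * g (S N) + f N * (g (S N) - g N))%C by ring.
    assert (H1 := Cmod_triangle ((f (S N) - f N) * g (S N)) (f N * (g (S N) - g N))).
    rewrite !Cmod_mult in H1.
    assert (Hf := Cmod_le_partial_var f (S N)); assert (Hg := Cmod_le_partial_var g (S N)).
    assert (Hf' := Cmod_le_partial_var f N); assert (Hg' := Cmod_le_partial_var g N).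
    simpl in Hf, Hg.
    assert (P1 := Cmod_ge_0 (f (S N) - f N)); assert (P2 := Cmod_ge_0 (g (S N) - g N)).
    assert (P3 := Cmod_ge_0 (f N)); assert (P4 := Cmod_ge_0 (g N)).
    assert (P5 := Cmod_ge_0 (f (S N))); assert (P6 := Cmod_ge_0 (g (S N))).
    assert (T1 := Cmod_triangle (f N) (f (S N) - f N)).
    assert (T2 := Cmod_triangle (g N) (g (S N) - g N)).
    replace (f N + (f (S N) - f N))%C with (f (S N)) in T1 by ring.
    replace (g N + (g (S N) - g N))%C with (g (S N)) in T2 by ring.
    set (a := Cmod (f (S N) - f N)) in *; set (b := Cmod (g (S N) - g N)) in *.
    set (F := partial_var f N) in *; set (G := partial_var g N) in *.
    set (p := Cmod (f N)) in *; set (q := Cmod (g N)) in *.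
    set (p' := Cmod (f (S N))) in *; set (q' := Cmod (g (S N))) in *.
    assert (E1 : p' * q' - p * q <= a * q' + p * b) by nra.
    assert (E2 : a * q' <= a * (G + b)) by nra.
    assert (E3 : p * b <= F * b) by nra.
    lra.
Qed.

Definition bounded_var (f : nat -> C) : Prop := exists M, forall N, partial_var f N <= M.

Record bv := Bv { bv_seq :> nat -> C; bv_bounded : bounded_var bv_seq }.

Lemma bv_ext (f g : bv) : (forall j, f j = g j) -> f = g.
Proof.
  destruct f as [f Hf], g as [g Hg]; simpl; intros H.
  apply functional_extensionality in H; subst g.
  f_equal; apply proof_irrelevance.
Qed.

Lemma bounded_var_plus (f g : nat -> C) :
  bounded_var f -> bounded_var g -> bounded_var (fun j => f j + g j)%C.
Proof.
  intros [M HM] [M' HM']; exists (M + M'); intros N.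
  generalize (partial_var_plus f g N) (HM N) (HM' N); lra.
Qed.

Lemma bounded_var_scal (c : C) (f : nat -> C) :
  bounded_var f -> bounded_var (fun j => c * f j)%C.
Proof.
  intros [M HM]; exists (Cmod c * M); intros N.
  rewrite partial_var_scal; apply Rmult_le_compat_l; [apply Cmod_ge_0|apply HM].
Qed.

Lemma bounded_var_mult (f g : nat -> C) :
  bounded_var f -> bounded_var g -> bounded_var (fun j => f j * g j)%C.
Proof.
  intros [M HM] [M' HM']; exists (2 * M * M'); intros N.
  assert (H := partial_var_mult f g N).
  assert (H1 := partial_var_ge_0 f N); assert (H2 := partial_var_ge_0 g N).
  assert (H3 := HM N); assert (H4 := HM' N).
  assert (partial_var f N * partial_var g N <= M * M') by (apply Rmult_le_compat; lra).
  lra.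
Qed.

Lemma bounded_var_opp (f : nat -> C) : bounded_var f -> bounded_var (fun j => - f j)%C.
Proof.
  intros Hf.
  replace (fun j => - f j)%C with (fun j => (- (1)) * f j)%C
    by (apply functional_extensionality; intros; ring).
  apply bounded_var_scal, Hf.
Qed.

Lemma bounded_var_const (c : C) : bounded_var (fun _ => c).
Proof.
  exists (Cmod c); induction N as [|N IH]; simpl; [lra|].
  replace (c - c)%C with (RtoC 0) by ring; rewrite Cmod_0; lra.
Qed.

Definition bv_plus (f g : bv) : bv := Bv _ (bounded_var_plus _ _ (bv_bounded f) (bv_bounded g)).
Definition bv_opp (f : bv) : bv := Bv _ (bounded_var_opp _ (bv_bounded f)).
Definition bv_const (c : C) : bv := Bv _ (bounded_var_const c).
Definition bv_scal (c : C) (f : bv) : bv := Bv _ (bounded_var_scal c _ (bv_bounded f)).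
Definition bv_mult (f g : bv) : bv := Bv _ (bounded_var_mult _ _ (bv_bounded f) (bv_bounded g)).

(** * The variation norm *)

Definition bv_norm (f : bv) : R := real (Lub_Rbar (fun r => exists N, r = partial_var f N)).

(** A member and an upper bound rule out the two infinite values, which [real] would send to 0. *)
Lemma real_Lub_Rbar_spec (E : R -> Prop) (x M : R) :
  E x -> (forall y, E y -> y <= M) ->
  (forall y, E y -> y <= real (Lub_Rbar E)) /\
  (forall B, (forall y, E y -> y <= B) -> real (Lub_Rbar E) <= B).
Proof.
  intros Hx HM; destruct (Lub_Rbar_correct E) as [Hub Hlub].
  assert (H1 := Hub x Hx); assert (H2 := Hlub (Finite M) HM).
  destruct (Lub_Rbar E) as [l| |]; simpl in *; try contradiction.
  split; [exact Hub|]; intros B HB; exact (Hlub (Finite B) HB).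
Qed.

Lemma bv_norm_spec (f : bv) :
  (forall N, partial_var f N <= bv_norm f) /\
  (forall B, (forall N, partial_var f N <= B) -> bv_norm f <= B).
Proof.
  destruct (bv_bounded f) as [M HM].
  destruct (real_Lub_Rbar_spec (fun r => exists N, r = partial_var f N) (partial_var f 0) M)
    as [H1 H2]; [now exists O|intros y [N ->]; apply HM|].
  split; [intros N; apply H1; now exists N|].
  intros B HB; apply H2; intros y [N ->]; apply HB.
Qed.

Lemma partial_var_le_norm (f : bv) (N : nat) : partial_var f N <= bv_norm f.
Proof. apply bv_norm_spec. Qed.

Lemma bv_norm_le (f : bv) (B : R) : (forall N, partial_var f N <= B) -> bv_norm f <= B.
Proof. apply bv_norm_spec. Qed.

Lemma bv_norm_ge_0 (f : bv) : 0 <= bv_norm f.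
Proof. eapply Rle_trans; [apply (partial_var_ge_0 f 0)|apply partial_var_le_norm]. Qed.

Lemma bv_norm_plus (f g : bv) : bv_norm (bv_plus f g) <= bv_norm f + bv_norm g.
Proof.
  apply bv_norm_le; intros N; simpl.
  generalize (partial_var_plus f g N) (partial_var_le_norm f N) (partial_var_le_norm g N); lra.
Qed.

Lemma bv_norm_scal (c : C) (f : bv) : bv_norm (bv_scal c f) <= Cmod c * bv_norm f.
Proof.
  apply bv_norm_le; intros N; simpl; rewrite partial_var_scal.
  apply Rmult_le_compat_l; [apply Cmod_ge_0|apply partial_var_le_norm].
Qed.

Lemma bv_norm_mult (f g : bv) : bv_norm (bv_mult f g) <= 2 * bv_norm f * bv_norm g.
Proof.
  apply bv_norm_le; intros N; simpl.
  assert (H := partial_var_mult f g N).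
  assert (H1 := partial_var_ge_0 f N); assert (H2 := partial_var_ge_0 g N).
  assert (H3 := partial_var_le_norm f N); assert (H4 := partial_var_le_norm g N).
  assert (partial_var f N * partial_var g N <= bv_norm f * bv_norm g)
    by (apply Rmult_le_compat; lra).
  lra.
Qed.

Lemma bv_norm_one : bv_norm (bv_const 1) <= 1.
Proof.
  apply bv_norm_le; induction N as [|N IH]; simpl in *; [rewrite Cmod_1; lra|].
  replace (1 - 1)%C with (RtoC 0) by ring; rewrite Cmod_0; lra.
Qed.

Lemma bv_norm_eq_0 (f : bv) : bv_norm f = 0 -> f = bv_const 0.
Proof.
  intros H; apply bv_ext; intros j; simpl; apply Cmod_eq_0, Rle_antisym; [|apply Cmod_ge_0].
  rewrite <- H; eapply Rle_trans; [apply Cmod_le_partial_var|apply partial_var_le_norm].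
Qed.

(** * Vector space and normed structure on [bv] *)

Lemma bv_plus_comm (f g : bv) : bv_plus f g = bv_plus g f.
Proof. apply bv_ext; intros j; simpl; ring. Qed.

Lemma bv_plus_assoc (f g h : bv) : bv_plus f (bv_plus g h) = bv_plus (bv_plus f g) h.
Proof. apply bv_ext; intros j; simpl; ring. Qed.

Lemma bv_plus_0 (f : bv) : bv_plus f (bv_const 0) = f.
Proof. apply bv_ext; intros j; simpl; ring. Qed.

Lemma bv_plus_opp (f : bv) : bv_plus f (bv_opp f) = bv_const 0.
Proof. apply bv_ext; intros j; simpl; ring. Qed.

Definition bv_AbelianGroup : AbelianGroup :=
  AbelianGroup.Pack bv
    (AbelianGroup.Class bv
       (AbelianMonoid.Mixin bv bv_plus (bv_const 0) bv_plus_comm bv_plus_assoc bv_plus_0)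
       (AbelianGroup.Mixin
          (AbelianMonoid.Pack bv
             (AbelianMonoid.Mixin bv bv_plus (bv_const 0) bv_plus_comm bv_plus_assoc bv_plus_0) bv)
          bv_opp bv_plus_opp)) bv.

Lemma bv_scal_assoc (x y : C_Ring) (f : bv_AbelianGroup) :
  bv_scal x (bv_scal y f) = bv_scal (mult x y) f.
Proof. apply bv_ext; intros j; simpl; unfold mult; simpl; ring. Qed.

Lemma bv_scal_one (f : bv_AbelianGroup) : bv_scal (one : C_Ring) f = f.
Proof. apply bv_ext; intros j; simpl; unfold one; simpl; ring. Qed.

Lemma bv_scal_plus_r (x : C_Ring) (f g : bv_AbelianGroup) :
  bv_scal x (plus f g) = plus (bv_scal x f : bv_AbelianGroup) (bv_scal x g).
Proof. apply bv_ext; intros j; simpl; ring. Qed.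

Lemma bv_scal_plus_l (x y : C_Ring) (f : bv_AbelianGroup) :
  bv_scal (plus x y) f = plus (bv_scal x f : bv_AbelianGroup) (bv_scal y f).
Proof. apply bv_ext; intros j; simpl; unfold plus; simpl; ring. Qed.

Definition bv_ModuleSpace_class : ModuleSpace.class_of C_Ring bv :=
  ModuleSpace.Class C_Ring bv (AbelianGroup.class bv_AbelianGroup)
    (ModuleSpace.Mixin C_Ring bv_AbelianGroup bv_scal
       bv_scal_assoc bv_scal_one bv_scal_plus_r bv_scal_plus_l).

Definition bv_ball (f : bv) (e : R) (g : bv) : Prop := bv_norm (bv_plus g (bv_opp f)) < e.

Lemma bv_ball_center (f : bv) (e : posreal) : bv_ball f e f.
Proof.
  eapply Rle_lt_trans; [apply (bv_norm_le _ 0)|apply e].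
  induction N as [|N IH]; simpl in *; rewrite ?Cplus_opp_r.
  - rewrite Cmod_0; lra.
  - replace (0 - 0)%C with (RtoC 0) by ring; rewrite Cmod_0; lra.
Qed.

Lemma bv_ball_sym (f g : bv) (e : R) : bv_ball f e g -> bv_ball g e f.
Proof.
  unfold bv_ball; intros H; eapply Rle_lt_trans; [|exact H].
  replace (bv_plus f (bv_opp g)) with (bv_scal (- (1))%C (bv_plus g (bv_opp f)))
    by (apply bv_ext; intros j; simpl; ring).
  eapply Rle_trans; [apply bv_norm_scal|]; rewrite Cmod_m1; lra.
Qed.

Lemma bv_ball_triangle (f g h : bv) (e1 e2 : R) :
  bv_ball f e1 g -> bv_ball g e2 h -> bv_ball f (e1 + e2) h.
Proof.
  unfold bv_ball; intros H1 H2.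
  replace (bv_plus h (bv_opp f)) with (bv_plus (bv_plus h (bv_opp g)) (bv_plus g (bv_opp f)))
    by (apply bv_ext; intros j; simpl; ring).
  eapply Rle_lt_trans; [apply bv_norm_plus|lra].
Qed.

Definition bv_UniformSpace_mixin : UniformSpace.mixin_of bv :=
  UniformSpace.Mixin bv (bv_const 0) bv_ball bv_ball_center bv_ball_sym bv_ball_triangle.

Definition bv_NormedModuleAux : NormedModuleAux C_AbsRing :=
  NormedModuleAux.Pack C_AbsRing bv
    (NormedModuleAux.Class C_AbsRing bv bv_ModuleSpace_class bv_UniformSpace_mixin) bv.

Lemma bv_ball_norm (f g : bv_NormedModuleAux) (e : posreal) :
  ball f e g -> bv_norm (minus g f) < 1 * e.
Proof. rewrite Rmult_1_l; exact (fun H => H). Qed.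

Definition bv_NormedModule : NormedModule C_AbsRing :=
  NormedModule.Pack C_AbsRing bv
    (NormedModule.Class C_AbsRing bv (NormedModuleAux.class C_AbsRing bv_NormedModuleAux)
       (NormedModule.Mixin C_AbsRing bv_NormedModuleAux bv_norm 1
          bv_norm_plus bv_norm_scal (fun _ _ _ H => H) bv_ball_norm bv_norm_eq_0)) bv.

(** * Completeness of [bv] *)

Definition bv_UniformSpace : UniformSpace := UniformSpace.Pack bv bv_UniformSpace_mixin bv.

Definition bv_lim (F : (bv -> Prop) -> Prop) : bv :=
  epsilon (inhabits (bv_const 0)) (fun f => forall e : posreal, F (bv_ball f e)).

(** For fixed [N], this makes [partial_var _ N] small as soon as finitely many coordinates are
    small; each increment costs at most two moduli. *)
Lemma partial_var_lt (f : nat -> C) (e : R) (N : nat) :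
  (forall j, (j <= N)%nat -> Cmod (f j) < e) -> partial_var f N <= 2 * (INR N + 1) * e.
Proof.
  induction N as [|N IH]; intros H; cbn [partial_var].
  - assert (H0 := H O (le_n 0)); assert (H1 := Cmod_ge_0 (f O)); simpl; lra.
  - assert (H1 := H (S N) (le_n _)); assert (H2 := H N ltac:(lia)).
    assert (H3 := Cmod_triangle (f (S N)) (- f N)); rewrite Cmod_opp in H3.
    unfold Cminus; rewrite S_INR.
    assert (IH' := IH ltac:(intros; apply H; lia)); nra.
Qed.

(* Coordinatewise limits exist since the coordinates are controlled by the norm;
   the partial variations are continuous for coordinatewise convergence, so the
   limit also exists in norm. *)
Lemma bv_complete (F : (bv -> Prop) -> Prop) :
  ProperFilter F -> (forall e : posreal, exists f, F (bv_ball f e)) ->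
  exists f, forall e : posreal, F (bv_ball f e).
Proof.
  intros FF HF.
  set (Fj := fun (j : nat) (P : C -> Prop) => F (fun f : bv => P (f j))).
  assert (PFj : forall j, ProperFilter (Fj j)).
  { intros j; exact (filtermap_proper_filter _ _ (fun f : bv => f j) F FF). }
  assert (Hcoord : forall (f g : bv) j e, bv_ball f e g -> Cmod (g j - f j) < e).
  { intros f g j e H; eapply Rle_lt_trans; [|exact H].
    eapply Rle_trans; [|apply (partial_var_le_norm _ j)].
    apply (Cmod_le_partial_var (bv_plus g (bv_opp f))). }
  set (c := fun j => lim (T := C_CompleteNormedModule) (Fj j) : C).
  assert (Hc : forall j (e : posreal), F (fun f : bv => Cmod (f j - c j) < e)).
  { intros j e.
    (* A uniform ball of the complex plane is a product of two real balls, so passing to the modulus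
       costs a factor [sqrt 2]. *)
    assert (He : 0 < e / sqrt 2) by (apply Rdiv_lt_0_compat; [apply e|apply Rlt_sqrt2_0]).
    assert (HC : cauchy (T := C_CompleteNormedModule) (Fj j)).
    { intros e'; destruct (HF e') as [f Hf]; exists (f j).
      unfold Fj; eapply filter_imp; [|exact Hf]; intros g Hg.
      apply C_NormedModule_mixin_compat1, Hcoord, Hg. }
    eapply filter_imp;
      [|exact (complete_cauchy (T := C_CompleteNormedModule) (Fj j) (PFj j) HC (mkposreal _ He))].
    intros f Hf; apply C_NormedModule_mixin_compat2 in Hf.
    eapply Rlt_le_trans; [exact Hf|]; simpl; right; field.
    apply Rgt_not_eq, Rlt_sqrt2_0. }
  clearbody c.
  assert (Hfin : forall (e : posreal) N,
    F (fun f : bv => forall j, (j <= N)%nat -> Cmod (f j - c j) < e)).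
  { intros e; induction N as [|N IH].
    - eapply filter_imp; [|exact (Hc O e)]; intros f Hf j Hj.
      now replace j with O by lia.
    - eapply filter_imp; [|exact (filter_and _ _ IH (Hc (S N) e))].
      intros f [H1 H2] j Hj; destruct (Nat.eq_dec j (S N)) as [->|Hne]; [exact H2|].
      apply H1; lia. }
  (* The bound is uniform in [N]. For each [N] and [eta], the filter provides some [g] that lies in
     the ball around [f] and is close to [c] in the coordinates up to [N]; it may depend on both. *)
  assert (Hvar : forall (f : bv) (e : posreal), F (bv_ball f e) ->
    forall N, partial_var (fun j => f j - c j)%C N <= e).
  { intros f e Hf N; apply le_epsilon; intros eta Heta.
    assert (HN : 0 < 2 * (INR N + 1)) by (assert (H := pos_INR N); lra).
    assert (He : 0 < eta / (2 * (INR N + 1))) by now apply Rdiv_lt_0_compat.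
    destruct (filter_ex _ (filter_and _ _ Hf (Hfin (mkposreal _ He) N))) as [g [H1 H2]].
    apply partial_var_lt in H2; simpl in H2.
    replace (2 * (INR N + 1) * (eta / (2 * (INR N + 1)))) with eta in H2 by (field; lra).
    apply bv_ball_sym in H1.
    assert (H3 := partial_var_le_norm (bv_plus f (bv_opp g)) N).
    assert (H4 := partial_var_plus (fun j => f j - g j)%C (fun j => g j - c j)%C N).
    rewrite (partial_var_ext _ (fun j => f j - c j)%C) in H4 by (intros; ring).
    unfold bv_ball in H1; simpl in H3; unfold Cminus at 2 in H4; lra. }
  assert (Bc : bounded_var c).
  { destruct (HF (mkposreal 1 Rlt_0_1)) as [f Hf].
    replace c with (fun j => f j + - (f j - c j))%C
      by (apply functional_extensionality; intros; ring).
    apply bounded_var_plus; [apply bv_bounded|].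
    apply bounded_var_opp; exists 1; exact (Hvar f _ Hf). }
  exists (Bv c Bc); intros e.
  assert (He : 0 < e / 3) by (assert (H := cond_pos e); lra).
  destruct (HF (mkposreal _ He)) as [f Hf].
  eapply filter_imp; [|exact Hf]; intros g Hg.
  (* [Hvar] gives a bound that is not strict, while balls are strict; the radius [2 * (e / 3)]
     around the limit absorbs the difference. *)
  replace (pos e) with (2 * (e / 3) + e / 3) by field.
  apply (bv_ball_triangle _ f); [|exact Hg].
  eapply Rle_lt_trans; [apply (bv_norm_le _ (e / 3)); exact (Hvar f _ Hf)|lra].
Qed.

Lemma bv_lim_ball (F : (bv -> Prop) -> Prop) :
  ProperFilter F -> cauchy (T := bv_UniformSpace) F ->
  forall e : posreal, F (ball (bv_lim F : bv_UniformSpace) e).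
Proof.
  intros FF HF.
  exact (epsilon_spec (inhabits (bv_const 0)) (fun f => forall e : posreal, F (bv_ball f e))
    (bv_complete F FF HF)).
Qed.

(** Filters that refine each other have the same members, so extensionality makes them equal and the
    chosen limits coincide. *)
Lemma bv_lim_close (F1 F2 : (bv -> Prop) -> Prop) :
  filter_le F1 F2 -> filter_le F2 F1 -> close (bv_lim F1 : bv_UniformSpace) (bv_lim F2).
Proof.
  intros H1 H2; replace F2 with F1; [apply close_refl|].
  apply functional_extensionality; intros P; apply propositional_extensionality; split; auto.
Qed.

Definition bv_CompleteNormedModule : CompleteNormedModule C_AbsRing :=
  CompleteNormedModule.Pack C_AbsRing bv
    (CompleteNormedModule.Class C_AbsRing bv (NormedModule.class C_AbsRing bv_NormedModule)
       (CompleteSpace.Mixin bv_UniformSpace bv_lim bv_lim_ball bv_lim_close)) bv.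

(** * Multiplication operators *)

Definition mult_op (m : bv) : bv_CompleteNormedModule -> bv_CompleteNormedModule := bv_mult m.

(** The lower bound comes from testing on the constant sequence 1, the upper one from
    [bv_norm_mult]. Assuming only pointwise agreement with a multiplication lets this apply to
    [resolvent] and to compositions of powers. *)
Lemma op_norm_mult_op (m : bv) (A : bv_CompleteNormedModule -> bv_CompleteNormedModule) :
  (forall f, A f = bv_mult m f) -> bv_norm m <= op_norm A <= 2 * bv_norm m.
Proof.
  intros HA; unfold op_norm.
  set (E := fun r => _).
  assert (HE : forall r, E r -> r <= 2 * bv_norm m).
  { intros r [f [Hf ->]]; rewrite HA; change (norm ?x) with (bv_norm x) in *.
    assert (H := bv_norm_mult m f); assert (H1 := bv_norm_ge_0 m); nra. }
  assert (Hm : E (bv_norm m)).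
  { exists (bv_const 1); split; [exact bv_norm_one|].
    rewrite HA; change (norm ?x) with (bv_norm x).
    f_equal; apply bv_ext; intros j; simpl; ring. }
  destruct (real_Lub_Rbar_spec E _ _ Hm HE) as [H1 H2]; auto.
Qed.

Lemma mult_op_linear (m : bv) : is_linear (mult_op m).
Proof.
  split.
  - intros f g; apply bv_ext; intros j; simpl; ring.
  - intros c f; apply bv_ext; intros j; simpl; ring.
  - exists (2 * bv_norm m + 1); assert (H := bv_norm_ge_0 m); split; [lra|].
    intros f; change (bv_norm (bv_mult m f) <= (2 * bv_norm m + 1) * bv_norm f).
    assert (H1 := bv_norm_mult m f); assert (H2 := bv_norm_ge_0 f); lra.
Qed.

Lemma op_pow_mult_op (m f : bv) (n j : nat) :
  (op_pow (mult_op m) n f : bv) j = (m j ^ n * f j)%C.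
Proof.
  unfold op_pow; induction n as [|n IH]; simpl; [ring|].
  simpl in IH; rewrite IH; ring.
Qed.

Lemma op_pow_id_minus_mult_op (m f : bv) (n j : nat) :
  (op_pow (id_minus (mult_op m)) n f : bv) j = ((1 - m j) ^ n * f j)%C.
Proof.
  unfold op_pow; induction n as [|n IH]; simpl; [ring|].
  simpl in IH; rewrite IH; ring.
Qed.

Lemma is_inverse_mult_op (m r : bv) (z : C) :
  (forall j, (z - m j) * r j = 1)%C ->
  is_inverse (scalar_minus z (mult_op m)) (mult_op r).
Proof.
  intros H; split; [apply mult_op_linear|].
  split; intros f; apply bv_ext; intros j; simpl;
    transitivity ((z - m j) * r j * f j)%C; try ring; rewrite H; ring.
Qed.

(** A left inverse and a right inverse of the same map agree, so the inverse chosen by [resolvent]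
    is multiplication by [r]. *)
Lemma op_norm_resolvent (m r : bv) (z : C) :
  (forall j, (z - m j) * r j = 1)%C ->
  op_norm (resolvent z (mult_op m)) <= 2 * bv_norm r.
Proof.
  intros H; apply (op_norm_mult_op r).
  assert (Hr := is_inverse_mult_op m r z H).
  assert (Hs := epsilon_spec (inhabits (fun x : bv_CompleteNormedModule => x)) _
    (ex_intro _ _ Hr)).
  intros f.
  change (resolvent z (mult_op m) f = mult_op r f).
  destruct Hr as [_ [Hr _]], Hs as [_ [_ Hs]].
  rewrite <- (Hr (resolvent z (mult_op m) f)).
  f_equal; apply Hs.
Qed.

(** In the uses below [g] is a multiple of an arctangent, so that [g N - g O] is bounded
    independently of [N]. *)
Lemma partial_var_telescope (f : nat -> C) (g : nat -> R) (N : nat) :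
  (forall j, Cmod (f (S j) - f j)%C <= g (S j) - g j) ->
  partial_var f N <= Cmod (f O) + (g N - g O).
Proof.
  intros H; induction N as [|N IH]; cbn [partial_var]; [lra|].
  specialize (H N); lra.
Qed.

Lemma partial_var_ge_sum (f : nat -> C) (c : R) (a l : nat) :
  (forall j, (a <= j < a + l)%nat -> c <= Cmod (f (S j) - f j)%C) ->
  INR l * c <= partial_var f (a + l).
Proof.
  induction l as [|l IH]; intros H.
  - simpl; rewrite Rmult_0_l; apply partial_var_ge_0.
  - replace (a + S l)%nat with (S (a + l)) by lia; cbn [partial_var]; rewrite S_INR.
    assert (H1 := H (a + l)%nat ltac:(lia)).
    assert (H2 := IH ltac:(intros; apply H; lia)); lra.
Qed.

(** * Differences of arctangents *)

Lemma sqrt_1_sqr_pos (x : R) : 0 < sqrt (1 + x²).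
Proof. apply sqrt_lt_R0; generalize (Rle_0_sqr x); lra. Qed.

Lemma sin_atan_minus (x y : R) :
  sin (atan y - atan x) = (y - x) / (sqrt (1 + x²) * sqrt (1 + y²)).
Proof.
  rewrite sin_minus, !sin_atan, !cos_atan.
  assert (Hx := sqrt_1_sqr_pos x); assert (Hy := sqrt_1_sqr_pos y); field; lra.
Qed.

(** An angle exceeds its sine; the left side is the sine of the angle under which the real segment
    from [x] to [y] is seen from [Ci]. *)
Lemma atan_minus_ge (x y : R) : x < y ->
  (y - x) / (sqrt (1 + x²) * sqrt (1 + y²)) <= atan y - atan x.
Proof.
  intros Hxy; rewrite <- sin_atan_minus; left; apply sin_lt_x.
  generalize (atan_increasing x y Hxy); lra.
Qed.

Lemma atan_minus_bounds (x y : R) : 0 <= x < y ->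
  (y - x) / (1 + y ^ 2) <= atan y - atan x <= (y - x) / (1 + x ^ 2).
Proof.
  intros [Hx Hxy].
  destruct (MVT_cor2 atan (fun c => / (1 + c ^ 2)) x y Hxy
    (fun c _ => derivable_pt_lim_atan c)) as [c [-> Hc]].
  rewrite Rmult_comm.
  split; (apply Rmult_le_compat_l; [lra|apply Rinv_le_contravar; nra]).
Qed.

Lemma atan_minus_le_PI (x y : R) : atan y - atan x <= PI.
Proof. generalize (atan_bound x) (atan_bound y); lra. Qed.

(** * The multiplier [j / (j + i)] *)

Definition lam (t : R) : C := (t / (t + Ci))%C.

Lemma R_plus_Ci_neq_0 (t : R) : (t + Ci)%C <> 0%C.
Proof. intros H; apply (f_equal snd) in H; simpl in H; lra. Qed.

Lemma Cmod_R_plus_Ci (t : R) : Cmod (t + Ci)%C = sqrt (1 + t²).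
Proof. unfold Cmod, Rsqr; simpl; f_equal; ring. Qed.

Lemma one_minus_lam (t : R) : (1 - lam t = Ci / (t + Ci))%C.
Proof. unfold lam; field; apply R_plus_Ci_neq_0. Qed.

Lemma Cmod_one_minus_lam (t : R) : Cmod (1 - lam t)%C = / sqrt (1 + t²).
Proof.
  rewrite one_minus_lam, Cmod_div, Cmod_Ci, Cmod_R_plus_Ci by apply R_plus_Ci_neq_0.
  unfold Rdiv; ring.
Qed.

Lemma Cmod_lam (t : R) : 0 <= t -> Cmod (lam t) = t / sqrt (1 + t²).
Proof.
  intros Ht; unfold lam.
  now rewrite Cmod_div, Cmod_R, Rabs_pos_eq, Cmod_R_plus_Ci by auto using R_plus_Ci_neq_0.
Qed.

(** Pythagoras in the right triangle 0, [lam t], 1 inscribed in the circle with diameter [0, 1]. *)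
Lemma Cmod_lam_circle (t : R) : Cmod (lam t) ^ 2 + Cmod (1 - lam t)%C ^ 2 = 1.
Proof.
  rewrite Cmod_one_minus_lam; unfold lam.
  rewrite Cmod_div, Cmod_R, Cmod_R_plus_Ci by apply R_plus_Ci_neq_0.
  assert (H := sqrt_1_sqr_pos t).
  assert (H1 : sqrt (1 + t²) ^ 2 = 1 + t²) by (apply pow2_sqrt; generalize (Rle_0_sqr t); lra).
  unfold Rdiv; rewrite Rpow_mult_distr, pow2_abs, pow_inv, H1.
  unfold Rsqr in *; field; nra.
Qed.

(** As [lam] is a Möbius map, the difference of two values is [s - t] times one factor per point,
    here [1 - lam], up to a unimodular constant. *)
Lemma Cmod_lam_minus (s t : R) :
  Cmod (lam s - lam t)%C = Rabs (s - t) * Cmod (1 - lam s)%C * Cmod (1 - lam t)%C.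
Proof.
  replace (lam s - lam t)%C with ((RtoC (s - t)) * (- Ci) * (1 - lam s) * (1 - lam t))%C.
  - rewrite !Cmod_mult, Cmod_opp, Cmod_Ci, Cmod_R; ring.
  - rewrite !one_minus_lam; unfold lam; rewrite RtoC_minus.
    assert (Hs := R_plus_Ci_neq_0 s); assert (Ht := R_plus_Ci_neq_0 t).
    transitivity (((s - t) * Ci * - (Ci * Ci)) / ((s + Ci) * (t + Ci)))%C; [field; auto|].
    replace (Ci * Ci)%C with (- (1))%C by (unfold Ci; apply injective_projections; simpl; ring).
    field; auto.
Qed.

(** Since [/ (1 - lam t) = 1 - Ci * t], taking [1 - lam t] out of [z - lam t] leaves
    [z - Ci * t * (z - 1)]. This is affine in [t], and its squared modulus is the quadratic under
    the root. *)
Lemma Cmod_minus_lam (z : C) (t : R) :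
  Cmod (z - lam t)%C = Cmod (1 - lam t)%C *
    sqrt (Cmod (z - 1)%C ^ 2 * t ^ 2 + 2 * Im z * t + Cmod z ^ 2).
Proof.
  replace (z - lam t)%C with ((1 - lam t) * (1 + (z - 1) * (1 - Ci * t)))%C.
  - rewrite Cmod_mult; f_equal; rewrite <- (sqrt_pow2 (Cmod _)) by apply Cmod_ge_0.
    f_equal; rewrite !Cmod2_alt; destruct z as [x y]; simpl; ring.
  - rewrite one_minus_lam; unfold lam; assert (Ht := R_plus_Ci_neq_0 t).
    transitivity ((Ci * z - z * (Ci * Ci) * t + (Ci * Ci) * t) / (t + Ci))%C; [field; auto|].
    replace (Ci * Ci)%C with (- (1))%C by (unfold Ci; apply injective_projections; simpl; ring).
    field; auto.
Qed.

Lemma bounded_var_lam : bounded_var (fun j => lam (INR j)).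
Proof.
  exists (1 + PI); intros N.
  eapply Rle_trans; [apply (partial_var_telescope _ (fun j => atan (INR j)))|].
  - intros j; rewrite Cmod_lam_minus, !Cmod_one_minus_lam.
    rewrite S_INR; replace (INR j + 1 - INR j) with 1 by ring; rewrite Rabs_R1.
    eapply Rle_trans; [|apply atan_minus_ge; lra].
    assert (Hx := sqrt_1_sqr_pos (INR j)); assert (Hy := sqrt_1_sqr_pos (INR j + 1)).
    right; field; lra.
  - cbv beta; rewrite Cmod_lam by (simpl; lra); simpl.
    assert (H := atan_minus_le_PI 0 (INR N)); unfold Rdiv; lra.
Qed.

Definition lam_bv : bv := Bv _ bounded_var_lam.

(** * Resolvent estimates *)

Lemma Cmod_minus_1_sqr (z : C) : Cmod (z - 1)%C ^ 2 = Cmod z ^ 2 - 2 * Re z + 1.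
Proof. rewrite !Cmod2_alt; destruct z as [x y]; simpl; ring. Qed.

Lemma Re_lt_Cmod_sqr (z : C) : 1 < Cmod z -> 0 < Cmod z ^ 2 - Re z.
Proof.
  intros Hz; assert (H := re_le_Cmod z); assert (H1 := Rle_abs (Re z)); nra.
Qed.

Lemma minus_lam_neq_0 (z : C) (t : R) : 1 < Cmod z -> (z - lam t)%C <> 0%C.
Proof.
  intros Hz H.
  assert (E : z = lam t) by (replace z with (z - lam t + lam t)%C by ring; rewrite H; ring).
  assert (H1 := Cmod_lam_circle t); rewrite <- E in H1.
  assert (H2 := pow2_ge_0 (Cmod (1 - z)%C)); nra.
Qed.

Lemma partial_var_resolvent (z : C) (N : nat) : 1 < Cmod z ->
  partial_var (fun j => / (z - lam (INR j)))%C N <= / Cmod z + PI / (Cmod z ^ 2 - Re z).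
Proof.
  intros Hz; assert (HW := Re_lt_Cmod_sqr z Hz).
  set (W := Cmod z ^ 2 - Re z) in *; set (D := Cmod (z - 1)%C ^ 2).
  assert (HD : 0 < D).
  { unfold D; rewrite Cmod_minus_1_sqr; fold W.
    assert (H := re_le_Cmod z); assert (H1 := Rle_abs (Re z)); nra. }
  (* Here [w = (Im z + Ci * W) / D], so [x j] is [(j + Re w) / Im w] and the differences of
     [atan (x j)] are the viewing angles from [-w]. *)
  set (x := fun j => (D * INR j + Im z) / W).
  eapply Rle_trans; [apply (partial_var_telescope _ (fun j => atan (x j) / W))|].
  - intros j; assert (Hj := minus_lam_neq_0 z (INR j) Hz).
    assert (HSj := minus_lam_neq_0 z (INR (S j)) Hz).
    replace (/ (z - lam (INR (S j))) - / (z - lam (INR j)))%C with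
      ((lam (INR (S j)) - lam (INR j)) * / (z - lam (INR (S j))) * / (z - lam (INR j)))%C
      by (field; auto).
    rewrite !Cmod_mult, !Cmod_inv by assumption.
    rewrite Cmod_lam_minus, !(Cmod_minus_lam z), !Cmod_one_minus_lam; fold D.
    (* Completing the square, by means of [D * Cmod z ^ 2 = Im z ^ 2 + W ^ 2]. *)
    assert (HQ : forall i, D * INR i ^ 2 + 2 * Im z * INR i + Cmod z ^ 2
      = (W / sqrt D) ^ 2 * (1 + (x i)²)).
    { intros i; unfold x, Rdiv; rewrite Rpow_mult_distr, pow_inv, pow2_sqrt by lra.
      unfold Rsqr; apply (Rmult_eq_reg_l D); [|lra].
      transitivity ((D * INR i + Im z) ^ 2 + W ^ 2); [|field; lra].
      assert (E1 : D = Cmod z ^ 2 - 2 * Re z + 1) by apply Cmod_minus_1_sqr.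
      assert (E2 := Cmod2_alt z).
      enough (D * Cmod z ^ 2 = Im z ^ 2 + W ^ 2) by lra.
      unfold W; rewrite E1, E2; ring. }
    assert (HsD : 0 < sqrt D) by now apply sqrt_lt_R0.
    assert (HWD : 0 < W / sqrt D) by now apply Rdiv_lt_0_compat.
    rewrite !HQ, !sqrt_mult_alt, !sqrt_pow2 by (try apply pow2_ge_0; lra).
    replace (INR (S j) - INR j) with 1 by (rewrite S_INR; ring); rewrite Rabs_R1.
    assert (Hx : x (S j) - x j = D / W) by (unfold x; rewrite S_INR; field; lra).
    assert (HA := atan_minus_ge (x j) (x (S j))
      ltac:(assert (0 < D / W) by (now apply Rdiv_lt_0_compat); lra)).
    rewrite Hx in HA.
    assert (P1 := sqrt_1_sqr_pos (x j)); assert (P2 := sqrt_1_sqr_pos (x (S j))).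
    assert (P3 := sqrt_1_sqr_pos (INR j)); assert (P4 := sqrt_1_sqr_pos (INR (S j))).
    apply (Rmult_le_reg_l W); [assumption|].
    replace (W * (atan (x (S j)) / W - atan (x j) / W)) with (atan (x (S j)) - atan (x j))
      by (field; lra).
    (* The factors [sqrt (1 + t²)] from [Cmod_lam_minus] and [Cmod_minus_lam] cancel, and what
       remains is exactly the sine in [HA]. *)
    eapply Rle_trans; [|exact HA]; right.
    rewrite <- (pow2_sqrt D) at 3 by lra; field; repeat split; lra.
  - cbv beta; replace (lam (INR 0)) with (RtoC 0) by (unfold lam; simpl; unfold Cdiv; ring).
    replace (z - 0)%C with z by ring.
    rewrite Cmod_inv by (intros ->; rewrite Cmod_0 in Hz; lra).
    apply Rplus_le_compat_l.
    replace (atan (x N) / W - atan (x O) / W) with ((atan (x N) - atan (x O)) / W)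
      by (field; lra).
    apply Rmult_le_compat_r; [left; now apply Rinv_0_lt_compat|apply atan_minus_le_PI].
Qed.

Lemma bounded_var_resolvent (z : C) : 1 < Cmod z ->
  bounded_var (fun j => / (z - lam (INR j)))%C.
Proof. intros Hz; eexists; intros N; apply (partial_var_resolvent z N Hz). Qed.

Definition resolvent_bv (z : C) (Hz : 1 < Cmod z) : bv := Bv _ (bounded_var_resolvent z Hz).

Lemma resolvent_bv_spec (z : C) (Hz : 1 < Cmod z) (j : nat) :
  ((z - lam_bv j) * resolvent_bv z Hz j = 1)%C.
Proof. simpl; apply Cinv_r, minus_lam_neq_0, Hz. Qed.

Lemma spectrum_lam (z : C) : spectrum (mult_op lam_bv) z -> Cmod z <= 1.
Proof.
  intros H; apply Rnot_lt_le; intros Hz; apply H.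
  exists (mult_op (resolvent_bv z Hz)).
  apply is_inverse_mult_op, resolvent_bv_spec.
Qed.

Lemma op_norm_resolvent_lam (z : C) : 1 < Cmod z ->
  op_norm (resolvent z (mult_op lam_bv)) <= 2 * (/ Cmod z + PI / (Cmod z ^ 2 - Re z)).
Proof.
  intros Hz.
  eapply Rle_trans; [apply (op_norm_resolvent _ (resolvent_bv z Hz)), resolvent_bv_spec|].
  apply Rmult_le_compat_l; [lra|apply bv_norm_le].
  intros N; now apply partial_var_resolvent.
Qed.

(** The denominator satisfies [Cmod z ^ 2 - Re z >= Cmod z * (Cmod z - 1) >= Cmod z - 1]. *)
Lemma kreiss_bounded_lam : kreiss_bounded (mult_op lam_bv).
Proof.
  split; [exact spectrum_lam|].
  assert (HP := PI_RGT_0).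
  exists (2 * (1 + PI)); split; [lra|]; intros z Hz.
  eapply Rle_trans; [now apply op_norm_resolvent_lam|].
  unfold Rdiv; rewrite Rmult_assoc; apply Rmult_le_compat_l; [lra|].
  rewrite Rmult_plus_distr_r, Rmult_1_l; apply Rplus_le_compat.
  - apply Rinv_le_contravar; lra.
  - apply Rmult_le_compat_l; [lra|]; apply Rinv_le_contravar; [lra|].
    assert (H := re_le_Cmod z); assert (H1 := Rle_abs (Re z)); nra.
Qed.

(** With [D = Cmod (z - 1) ^ 2], twice [Cmod z ^ 2 - Re z] exceeds [D] by [Cmod z ^ 2 - 1 > 0]; this
    gives the term [2 * PI]. The 9 comes from [D <= 9] when [Cmod z < 2], whence
    [/ Cmod z <= 1 <= 9 / D]. *)
Lemma two_Ritt_lam : two_Ritt (mult_op lam_bv).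
Proof.
  split; [exact spectrum_lam|].
  assert (HP := PI_RGT_0).
  exists (2 * (9 + 2 * PI)); split; [lra|]; intros z [Hz Hz2].
  eapply Rle_trans; [now apply op_norm_resolvent_lam|].
  assert (E := Cmod_minus_1_sqr z); assert (HW := Re_lt_Cmod_sqr z Hz).
  assert (HR := re_le_Cmod z); assert (HR1 := Rle_abs (Re z)).
  assert (HR2 := Rle_abs (- Re z)); rewrite Rabs_Ropp in HR2.
  set (D := Cmod (z - 1)%C ^ 2) in *.
  assert (HD : 0 < D) by nra.
  unfold Rdiv; rewrite Rmult_assoc; apply Rmult_le_compat_l; [lra|].
  rewrite Rmult_plus_distr_r; apply Rplus_le_compat.
  - apply Rle_trans with 1; [rewrite <- Rinv_1; apply Rinv_le_contravar; lra|].
    apply (Rmult_le_reg_r D); [assumption|]; rewrite Rmult_assoc, Rinv_l by lra; nra.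
  - rewrite (Rmult_comm 2), Rmult_assoc; apply Rmult_le_compat_l; [lra|].
    replace (2 * / D) with (/ (D / 2)) by (field; lra); apply Rinv_le_contravar; [lra|nra].
Qed.

(** * Upper bound for the powers *)

Lemma exp_INR_mult (x : R) (n : nat) : exp (INR n * x) = exp x ^ n.
Proof.
  induction n as [|n IH]; [simpl; rewrite Rmult_0_l; apply exp_0|].
  rewrite S_INR, Rmult_plus_distr_r, exp_plus, IH, Rmult_1_l; simpl; ring.
Qed.

(** For positive [q], raise [y / q <= exp (y / q)] to the power [q]. *)
Lemma pow_le_exp (y : R) (q : nat) : 0 <= y -> y ^ q <= INR q ^ q * exp y.
Proof.
  intros Hy; destruct q as [|q].
  - assert (H := exp_ineq1_le y); simpl; lra.
  - assert (Hq : 0 < INR (S q)) by apply lt_0_INR, Nat.lt_0_succ.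
    replace y with (INR (S q) * (y / INR (S q))) at 2 by (field; lra).
    rewrite exp_INR_mult, <- Rpow_mult_distr; apply pow_incr; split; [assumption|].
    assert (H := exp_ineq1_le (y / INR (S q))).
    replace y with (INR (S q) * (y / INR (S q))) at 1 by (field; lra).
    apply Rmult_le_compat_l; lra.
Qed.

(** The factor [(1 - x) ^ n <= exp (- n x)] cancels the exponential in [pow_le_exp]. *)
Lemma pow_mult_one_minus_pow_le (x : R) (q n : nat) : 0 <= x <= 1 ->
  (INR n * x) ^ q * (1 - x) ^ n <= INR q ^ q.
Proof.
  intros Hx; assert (Hn := pos_INR n); assert (Hq := pow_le _ q (pos_INR q)).
  assert (H1 := pow_le_exp (INR n * x) q ltac:(nra)).
  assert (H2 : (1 - x) ^ n <= exp (- (INR n * x))).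
  { rewrite Ropp_mult_distr_r, exp_INR_mult; apply pow_incr.
    generalize (exp_ineq1_le (- x)); lra. }
  assert (H3 : 0 <= (1 - x) ^ n) by (apply pow_le; lra).
  assert (H4 := exp_pos (INR n * x)).
  apply Rle_trans with (INR q ^ q * exp (INR n * x) * exp (- (INR n * x))).
  - apply Rmult_le_compat; try assumption; apply pow_le; nra.
  - rewrite Rmult_assoc, <- exp_plus, Rplus_opp_r, exp_0; lra.
Qed.

(** The square of the left side is the previous expression at [x = d ^ 2], and [A ^ 2 <= B] implies
    [A <= 1 + B]. *)
Lemma circle_pow_le (d r : R) (q n : nat) : 0 <= d -> 0 <= r -> r ^ 2 + d ^ 2 = 1 ->
  (sqrt (INR n) * d) ^ q * r ^ n <= 1 + INR q ^ q.
Proof.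
  intros Hd Hr H.
  assert (Hs : sqrt (INR n) ^ 2 = INR n) by apply pow2_sqrt, pos_INR.
  assert (H1 := pow_mult_one_minus_pow_le (d ^ 2) q n ltac:(nra)).
  replace (1 - d ^ 2) with (r ^ 2) in H1 by lra.
  rewrite <- Hs, <- Rpow_mult_distr, <- !pow_mult, !(Nat.mul_comm 2), !pow_mult,
    <- Rpow_mult_distr in H1.
  set (A := (sqrt (INR n) * d) ^ q * r ^ n) in *.
  assert (0 <= INR q ^ q) by apply pow_le, pos_INR.
  nra.
Qed.

Lemma Cmod_pow_minus_le (a b : C) (rho : R) (n : nat) : Cmod a <= rho -> Cmod b <= rho ->
  Cmod (b ^ n - a ^ n)%C <= INR n * rho ^ pred n * Cmod (b - a)%C.
Proof.
  intros Ha Hb; assert (Hab := Cmod_ge_0 (b - a)%C).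
  assert (Hrho : 0 <= rho) by (generalize (Cmod_ge_0 a); lra).
  induction n as [|n IH].
  - simpl; replace (1 - 1)%C with (RtoC 0) by ring; rewrite Cmod_0; lra.
  - replace (b ^ S n - a ^ S n)%C with (b * (b ^ n - a ^ n) + (b - a) * a ^ n)%C
      by (rewrite !Cpow_S; ring).
    eapply Rle_trans; [apply Cmod_triangle|]; rewrite !Cmod_mult, Cmod_pow.
    assert (H1 : Cmod a ^ n <= rho ^ n)
      by (apply pow_incr; split; [apply Cmod_ge_0|assumption]).
    assert (H2 : Cmod b * Cmod (b ^ n - a ^ n)%C <= INR n * rho ^ n * Cmod (b - a)%C).
    { apply Rle_trans with (rho * (INR n * rho ^ pred n * Cmod (b - a)%C)).
      - apply Rmult_le_compat; auto using Cmod_ge_0.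
      - right; destruct n; simpl; ring. }
    rewrite S_INR; simpl pred; nra.
Qed.

Definition power_mult (n k j : nat) : C := (lam (INR j) ^ n * (1 - lam (INR j)) ^ k)%C.

(** The first line pays for the increment of [lam ^ n]: 4 is 2 from [r ^ pred n <= 2 * r ^ n] times
    2 from [e <= 2 * d]. The second pays for the increment of [(1 - lam) ^ k], with [2 ^ k] from
    [e ^ k <= (2 * d) ^ k]. The powers are bounds from [circle_pow_le], at exponents that differ by
    2. *)
Definition upper_const (k : nat) : R :=
  4 * ((1 + INR k ^ k) + (1 + INR (k + 2) ^ (k + 2)))
  + INR k * 2 ^ k * ((1 + INR (pred k) ^ pred k) + (1 + INR (S k) ^ S k)).

Lemma INR_pow_self_ge_0 (q : nat) : 0 <= INR q ^ q.
Proof. apply pow_le, pos_INR. Qed.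

(* [d] and [e] are the distances of two consecutive values of [lam] to 1, [r] is
   the modulus of the second one. *)
Lemma increment_bound (d e r : R) (n k : nat) : (1 <= n)%nat ->
  0 < d -> 0 <= e <= 2 * d -> / 2 <= r -> r ^ 2 + d ^ 2 = 1 ->
  INR n * r ^ pred n * (d * e) * d ^ k + r ^ n * (INR k * e ^ pred k * (d * e))
  <= upper_const k * INR n / sqrt (INR n) ^ k / (/ d ^ 2 - 1 + INR n).
Proof.
  intros Hn Hd He Hr Hc.
  assert (Hn1 : 1 <= INR n) by (apply (le_INR 1); assumption).
  set (s := sqrt (INR n)).
  assert (Hs2 : s ^ 2 = INR n) by (apply pow2_sqrt; lra).
  assert (Hs : 1 <= s) by (unfold s; rewrite <- sqrt_1; apply sqrt_le_1; lra).
  assert (HK : forall q, (s * d) ^ q * r ^ n <= 1 + INR q ^ q)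
    by (intros q; apply circle_pow_le; lra).
  assert (Hrn : 0 <= r ^ n) by (apply pow_le; lra).
  assert (Hk := pos_INR k).
  assert (Hsk : 0 < s ^ k) by (apply pow_lt; lra).
  assert (Hd2 : 0 < d ^ 2) by nra.
  assert (Hi : 1 <= / d ^ 2) by (rewrite <- Rinv_1; apply Rinv_le_contravar; nra).
  set (Q := / d ^ 2 - 1 + INR n).
  assert (HQ : 0 < Q) by (unfold Q; lra).
  (* In the application [/ d ^ 2 - 1] is the square of the index. Multiplying by [Q] is thus traded
     for [1 + (s * d) ^ 2], which raises the exponent in [HK] by 0 or 2. *)
  assert (HdQ : d ^ 2 * Q <= 1 + (s * d) ^ 2).
  { unfold Q; rewrite Rpow_mult_distr, Hs2.
    replace (d ^ 2 * (/ d ^ 2 - 1 + INR n)) with (1 - d ^ 2 + INR n * d ^ 2) by (field; lra).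
    lra. }
  assert (H1 : INR n * r ^ pred n * (d * e) * d ^ k <= 4 * INR n * d ^ 2 * d ^ k * r ^ n).
  { assert (Hp : r ^ pred n <= 2 * r ^ n).
    { destruct n as [|n]; [lia|]; simpl.
      assert (0 <= r ^ n) by (apply pow_le; lra); nra. }
    assert (Hp0 : 0 <= r ^ pred n) by (apply pow_le; lra).
    assert (Hdk : 0 <= d ^ k) by (apply pow_le; lra).
    assert (Hp1 : r ^ pred n * (d * e) <= (2 * r ^ n) * (2 * d ^ 2))
      by (apply Rmult_le_compat; nra).
    replace (4 * INR n * d ^ 2 * d ^ k * r ^ n)
      with (INR n * d ^ k * (2 * r ^ n * (2 * d ^ 2))) by ring.
    replace (INR n * r ^ pred n * (d * e) * d ^ k)
      with (INR n * d ^ k * (r ^ pred n * (d * e))) by ring.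
    apply Rmult_le_compat_l; [nra|assumption]. }
  assert (H2 : INR k * e ^ pred k * (d * e) <= INR k * 2 ^ k * d ^ pred k * d ^ 2).
  { destruct k as [|k]; [simpl; lra|]; cbn [pred].
    assert (Hp : e ^ S k <= (2 * d) ^ S k) by (apply pow_incr; lra).
    rewrite Rpow_mult_distr in Hp.
    replace (INR (S k) * 2 ^ S k * d ^ k * d ^ 2) with (INR (S k) * d * (2 ^ S k * d ^ S k))
      by (simpl; ring).
    replace (INR (S k) * e ^ k * (d * e)) with (INR (S k) * d * e ^ S k) by (simpl; ring).
    apply Rmult_le_compat_l; [nra|assumption]. }
  assert (H1' : 4 * INR n * d ^ 2 * d ^ k * r ^ n * Q * s ^ k
    <= 4 * INR n * ((1 + INR k ^ k) + (1 + INR (k + 2) ^ (k + 2)))).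
  { assert (A1 := HK k); assert (A2 := HK (k + 2)%nat); rewrite pow_add in A2.
    replace (4 * INR n * d ^ 2 * d ^ k * r ^ n * Q * s ^ k)
      with (4 * INR n * ((s * d) ^ k * r ^ n * (d ^ 2 * Q))) by (rewrite Rpow_mult_distr; ring).
    apply Rmult_le_compat_l; [lra|].
    apply Rle_trans with ((s * d) ^ k * r ^ n * (1 + (s * d) ^ 2)); [|lra].
    apply Rmult_le_compat_l; [|assumption].
    apply Rmult_le_pos; [apply pow_le; nra|assumption]. }
  assert (H2' : r ^ n * (INR k * 2 ^ k * d ^ pred k * d ^ 2) * Q * s ^ k
    <= INR n * (INR k * 2 ^ k * ((1 + INR (pred k) ^ pred k) + (1 + INR (S k) ^ S k)))).
  { destruct k as [|k]; [simpl; lra|]; cbn [pred].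
    assert (A1 := HK k); assert (A2 := HK (S (S k))).
    assert (H2k : 0 < 2 ^ S k) by (apply pow_lt; lra).
    (* Only [k] of the [S k] factors [s] are matched with a [d]; the remaining one is bounded by
       [INR n]. *)
    assert (Hsn : s <= INR n) by nra.
    assert (HB : (s * d) ^ k * r ^ n * (d ^ 2 * Q) <=
      (1 + INR k ^ k) + (1 + INR (S (S k)) ^ S (S k))).
    { apply Rle_trans with ((s * d) ^ k * r ^ n * (1 + (s * d) ^ 2)); [|simpl in *; lra].
      apply Rmult_le_compat_l; [|assumption].
      apply Rmult_le_pos; [apply pow_le; nra|assumption]. }
    replace (r ^ n * (INR (S k) * 2 ^ S k * d ^ k * d ^ 2) * Q * s ^ S k)
      with (s * (INR (S k) * 2 ^ S k * ((s * d) ^ k * r ^ n * (d ^ 2 * Q))))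
      by (rewrite Rpow_mult_distr; simpl; ring).
    assert (HL : 0 <= (s * d) ^ k * r ^ n * (d ^ 2 * Q)).
    { repeat apply Rmult_le_pos; try apply pow_le; try lra; nra. }
    apply Rmult_le_compat; [lra| |assumption|].
    - apply Rmult_le_pos; [|assumption]; nra.
    - apply Rmult_le_compat_l; [nra|assumption]. }
  apply (Rmult_le_reg_r (Q * s ^ k)); [now apply Rmult_lt_0_compat|].
  replace (upper_const k * INR n / s ^ k / Q * (Q * s ^ k)) with (INR n * upper_const k)
    by (field; lra).
  apply (Rmult_le_compat_l (r ^ n)) in H2; [|assumption].
  assert (HQs : 0 < Q * s ^ k) by now apply Rmult_lt_0_compat.
  apply Rle_trans with ((4 * INR n * d ^ 2 * d ^ k * r ^ n
    + r ^ n * (INR k * 2 ^ k * d ^ pred k * d ^ 2)) * (Q * s ^ k)).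
  - apply Rmult_le_compat_r; lra.
  - unfold upper_const; lra.
Qed.

(** Product rule for differences: along the sequence the modulus of [lam] increases and the distance
    to 1 decreases, so [r] and [e] bound the respective powers at both points. *)
Lemma power_mult_increment (n k j : nat) : (1 <= n)%nat ->
  Cmod (power_mult n k (S j) - power_mult n k j)%C
  <= upper_const k * INR n / sqrt (INR n) ^ k / (INR (S j) ^ 2 + INR n).
Proof.
  intros Hn; unfold power_mult.
  set (a := lam (INR j)); set (b := lam (INR (S j))).
  assert (Hj := pos_INR j).
  assert (HSj : INR (S j) = INR j + 1) by apply S_INR.
  set (d := Cmod (1 - b)%C); set (e := Cmod (1 - a)%C); set (r := Cmod b).
  assert (Pj := sqrt_1_sqr_pos (INR j)); assert (PSj := sqrt_1_sqr_pos (INR (S j))).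
  assert (Ed : d = / sqrt (1 + (INR (S j))²)) by apply Cmod_one_minus_lam.
  assert (Ee : e = / sqrt (1 + (INR j)²)) by apply Cmod_one_minus_lam.
  assert (Hd : 0 < d) by (rewrite Ed; now apply Rinv_0_lt_compat).
  assert (He : 0 < e) by (rewrite Ee; now apply Rinv_0_lt_compat).
  assert (Ed2 : / d ^ 2 = 1 + INR (S j) ^ 2).
  { rewrite Ed, pow_inv, Rinv_inv, pow2_sqrt by (generalize (Rle_0_sqr (INR (S j))); lra).
    unfold Rsqr; ring. }
  assert (Hrd : r ^ 2 + d ^ 2 = 1) by apply Cmod_lam_circle.
  assert (Hae : Cmod a ^ 2 + e ^ 2 = 1) by apply Cmod_lam_circle.
  assert (Hr0 : 0 <= r) by apply Cmod_ge_0.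
  assert (Ha0 : 0 <= Cmod a) by apply Cmod_ge_0.
  assert (Hde : d <= e).
  { rewrite Ed, Ee; apply Rinv_le_contravar; [assumption|].
    apply sqrt_le_1_alt; rewrite HSj; unfold Rsqr; nra. }
  assert (He2 : e <= 2 * d).
  { rewrite Ed, Ee; apply (Rmult_le_reg_l (sqrt (1 + (INR j)²) * sqrt (1 + (INR (S j))²)));
      [now apply Rmult_lt_0_compat|].
    replace (_ * / sqrt (1 + (INR j)²)) with (sqrt (1 + (INR (S j))²)) by (field; lra).
    replace (_ * (2 * / _)) with (2 * sqrt (1 + (INR j)²)) by (field; lra).
    rewrite <- (sqrt_pow2 2) by lra; rewrite <- sqrt_mult_alt by lra.
    apply sqrt_le_1_alt; rewrite HSj; unfold Rsqr; nra. }
  assert (Har : Cmod a <= r) by nra.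
  (* The index [S j] is at least 1, so [d ^ 2 <= / 2]. This is why [r] is taken at the second point:
     at index 0 the value of [lam] is 0. *)
  assert (Hr : / 2 <= r).
  { assert (/ 2 * d ^ 2 <= / 4).
    { replace (d ^ 2) with (/ (1 + INR (S j) ^ 2)) by (rewrite <- Ed2; apply Rinv_inv).
      assert (/ (1 + INR (S j) ^ 2) <= / 2) by (apply Rinv_le_contravar; nra); lra. }
    nra. }
  assert (HB := increment_bound d e r n k Hn Hd ltac:(lra) Hr Hrd).
  rewrite Ed2 in HB; replace (1 + INR (S j) ^ 2 - 1) with (INR (S j) ^ 2) in HB by ring.
  eapply Rle_trans; [|exact HB].
  replace (b ^ n * (1 - b) ^ k - a ^ n * (1 - a) ^ k)%C
    with ((b ^ n - a ^ n) * (1 - b) ^ k + a ^ n * ((1 - b) ^ k - (1 - a) ^ k))%C by ring.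
  eapply Rle_trans; [apply Cmod_triangle|]; rewrite !Cmod_mult, !Cmod_pow; fold d.
  assert (Hba : Cmod (b - a)%C = d * e).
  { unfold b, a; rewrite Cmod_lam_minus; fold b a d e.
    replace (INR (S j) - INR j) with 1 by lra; rewrite Rabs_R1; ring. }
  assert (A1 := Cmod_pow_minus_le a b r n Har (Rle_refl _)).
  assert (A2 := Cmod_pow_minus_le (1 - a) (1 - b) e k (Rle_refl _) Hde).
  replace (1 - b - (1 - a))%C with (- (b - a))%C in A2 by ring.
  rewrite Cmod_opp in A2; rewrite Hba in A1, A2.
  apply Rplus_le_compat.
  - apply Rmult_le_compat_r; [apply pow_le; lra|assumption].
  - apply Rmult_le_compat; try apply pow_le; try apply Cmod_ge_0; try assumption.
    apply pow_incr; lra.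
Qed.

Lemma upper_const_ge_0 (k : nat) : 0 <= upper_const k.
Proof.
  unfold upper_const.
  assert (H1 := INR_pow_self_ge_0 k); assert (H2 := INR_pow_self_ge_0 (k + 2)).
  assert (H3 := INR_pow_self_ge_0 (pred k)); assert (H4 := INR_pow_self_ge_0 (S k)).
  assert (H5 := pos_INR k); assert (H6 : 0 < 2 ^ k) by (apply pow_lt; lra).
  apply Rplus_le_le_0_compat; [lra|].
  apply Rmult_le_pos; [nra|lra].
Qed.

(** Comparison of a sum with an integral: [1 / (t ^ 2 + n)] decreases for [t >= 0] and has
    antiderivative [atan (t / s) / s], so the sum over [j] is at most [PI / s]. *)
Lemma partial_var_power_le (n k N : nat) : (1 <= n)%nat ->
  partial_var (power_mult n k) N <= upper_const k * PI * (sqrt (INR n) * / sqrt (INR n) ^ k).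
Proof.
  intros Hn.
  assert (Hn1 : 1 <= INR n) by (apply (le_INR 1); assumption).
  set (s := sqrt (INR n)).
  assert (Hs2 : s ^ 2 = INR n) by (apply pow2_sqrt; lra).
  assert (Hs : 1 <= s) by (unfold s; rewrite <- sqrt_1; apply sqrt_le_1; lra).
  assert (Hsk : 0 < s ^ k) by (apply pow_lt; lra).
  assert (HU := upper_const_ge_0 k).
  set (c := upper_const k * INR n / s ^ k / s).
  assert (Hc0 : 0 <= c).
  { unfold c, Rdiv; repeat apply Rmult_le_pos; try lra; left; apply Rinv_0_lt_compat; lra. }
  eapply Rle_trans; [apply (partial_var_telescope _ (fun j => c * atan (INR j / s)))|].
  - intros j; eapply Rle_trans; [now apply power_mult_increment|]; fold s.
    rewrite <- Rmult_minus_distr_l.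
    assert (Hj := pos_INR j).
    assert (Hjs : 0 <= INR j / s) by (apply Rdiv_le_0_compat; lra).
    assert (HSjs : INR (S j) / s = INR j / s + / s) by (rewrite S_INR; field; lra).
    assert (Hsi : 0 < / s) by (apply Rinv_0_lt_compat; lra).
    destruct (atan_minus_bounds (INR j / s) (INR (S j) / s) ltac:(lra)) as [HA _].
    apply (Rmult_le_compat_l c) in HA; [|assumption].
    eapply Rle_trans; [|exact HA]; right.
    unfold c; rewrite HSjs at 1; rewrite <- Hs2; field; repeat split; try lra.
    assert (0 <= INR (S j) ^ 2) by apply pow2_ge_0; nra.
  (* For [n >= 1] the sequence starts at 0 because [lam 0 = 0], so the initial modulus contributes
     nothing. *)
  - assert (H0 : power_mult n k 0 = 0%C).
    { unfold power_mult.
      replace (lam (INR 0)) with (RtoC 0) by (unfold lam; simpl; unfold Cdiv; ring).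
      destruct n as [|n]; [lia|]; rewrite Cpow_S; ring. }
    rewrite H0, Cmod_0, Rplus_0_l, <- Rmult_minus_distr_l.
    apply Rle_trans with (c * PI); [apply Rmult_le_compat_l; [assumption|apply atan_minus_le_PI]|].
    right; unfold c; rewrite <- Hs2; field; lra.
Qed.

(** * Lower bound for the powers *)

Definition cis (x : R) : C := (cos x, sin x).

Lemma cis_pow (x : R) (n : nat) : (cis x ^ n)%C = cis (INR n * x).
Proof.
  induction n as [|n IH].
  - simpl; unfold cis; rewrite Rmult_0_l, cos_0, sin_0; reflexivity.
  - rewrite Cpow_S, IH, S_INR; unfold cis.
    rewrite Rmult_plus_distr_r, Rmult_1_l, cos_plus, sin_plus.
    apply injective_projections; simpl; ring.
Qed.

(* The right-hand side dominates the distance from [x cis(theta)] to the line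
   spanned by [cis(phi)]. *)
Lemma Cmod_cis_minus_ge (x y theta phi : R) :
  x * sin (phi - theta) <= Cmod (y * cis phi - x * cis theta)%C.
Proof.
  apply Rsqr_incr_0_var; [|apply Cmod_ge_0].
  rewrite !Rsqr_pow2, Cmod2_alt, sin_minus; unfold cis; simpl.
  assert (H1 := sin2_cos2 theta); assert (H2 := sin2_cos2 phi).
  unfold Rsqr in H1, H2.
  set (a := cos theta) in *; set (b := sin theta) in *.
  set (c := cos phi) in *; set (d := sin phi) in *.
  (* Pythagoras along the direction [cis phi]: the squared distance is [(x * sin (phi - theta)) ^ 2
     + (y - x * cos (phi - theta)) ^ 2]. *)
  assert (H3 := pow2_ge_0 (y - x * (a * c + b * d))).
  replace (y * c - 0 * d + - (x * a - 0 * b)) with (y * c - x * a) by ring.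
  replace (y * d + 0 * c + - (x * b + 0 * a)) with (y * d - x * b) by ring.
  assert (H4 : (y * c - x * a) ^ 2 + (y * d - x * b) ^ 2
    - (x * (d * a - c * b)) ^ 2 - (y - x * (a * c + b * d)) ^ 2 = 0); [|simpl in *; lra].
  transitivity (y ^ 2 * ((d * d + c * c) - 1) + x ^ 2 * (b * b + a * a) * (1 - (d * d + c * c)));
    [ring|].
  rewrite H2; ring.
Qed.

(** With [alpha = atan t], both [lam t] and [1 - lam t] are real multiples of [cis alpha], up to the
    constant [- Ci]. Hence the argument of [power_mult n k] is [(n + k) * alpha] up to a
    constant. *)
Lemma lam_polar (t : R) : lam t = (- Ci * sin (atan t) * cis (atan t))%C.
Proof.
  unfold lam, cis; rewrite sin_atan, cos_atan.
  assert (HS := sqrt_1_sqr_pos t).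
  assert (HS2 : sqrt (1 + t²) ^ 2 = 1 + t * t)
    by (apply pow2_sqrt; nra).
  set (S := sqrt (1 + t²)) in *.
  assert (E : forall u : R, u / (1 + t * t) = u / S ^ 2) by (intros u; now rewrite HS2).
  apply injective_projections; simpl;
    [transitivity (t * t / (1 + t * t))|transitivity (- t / (1 + t * t))];
    try (field; nra); rewrite E; field; lra.
Qed.

Lemma one_minus_lam_polar (t : R) : (1 - lam t = cos (atan t) * cis (atan t))%C.
Proof.
  rewrite lam_polar; unfold cis.
  assert (H := sin2_cos2 (atan t)); unfold Rsqr in H.
  apply injective_projections; simpl; lra.
Qed.

Lemma power_mult_polar (n k j : nat) :
  power_mult n k j = ((- Ci) ^ n
    * (RtoC (sin (atan (INR j)) ^ n * cos (atan (INR j)) ^ k)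
       * cis (INR (n + k) * atan (INR j))))%C.
Proof.
  unfold power_mult; rewrite one_minus_lam_polar, lam_polar, <- cis_pow.
  rewrite RtoC_mult, !RtoC_pow, !Cpow_mult_l, Cpow_add_r; ring.
Qed.

Lemma power_mult_increment_ge (n k j : nat) :
  sin (atan (INR j)) ^ n * cos (atan (INR j)) ^ k
    * sin (INR (n + k) * (atan (INR (S j)) - atan (INR j)))
  <= Cmod (power_mult n k (S j) - power_mult n k j)%C.
Proof.
  rewrite !power_mult_polar.
  match goal with |- _ <= Cmod (?x * ?y - ?x * ?z)%C =>
    replace (x * y - x * z)%C with (x * (y - z))%C by ring end.
  rewrite Cmod_mult, Cmod_pow, Cmod_opp, Cmod_Ci, pow1, Rmult_1_l, Rmult_minus_distr_l.
  apply Cmod_cis_minus_ge.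
Qed.

(** The sine is at least its square, which is [/ (1 + / t ^ 2) >= exp (- / t ^ 2)]; the [n]-th power
    is then at least [exp (- n / t ^ 2)]. *)
Lemma sin_atan_pow_ge (t : R) (n : nat) : 0 < t -> INR n <= t ^ 2 ->
  exp (- (1)) <= sin (atan t) ^ n.
Proof.
  intros Ht Hn; rewrite sin_atan.
  assert (HS := sqrt_1_sqr_pos t).
  assert (H1 : 1 <= sqrt (1 + t²)).
  { rewrite <- sqrt_1 at 1; apply sqrt_le_1_alt; generalize (Rle_0_sqr t); lra. }
  assert (HS2 : sqrt (1 + t²) ^ 2 = 1 + t ^ 2)
    by (rewrite pow2_sqrt by (generalize (Rle_0_sqr t); lra); unfold Rsqr; ring).
  set (S := sqrt (1 + t²)) in *.
  assert (Ht2 : 0 < t ^ 2) by nra.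
  assert (HtS : t <= S) by nra.
  apply Rle_trans with (exp (- / t ^ 2) ^ n).
  - rewrite <- exp_INR_mult.
    enough (H : - (1) <= INR n * - / t ^ 2)
      by (destruct H as [H|H]; [left; now apply exp_increasing|rewrite H; apply Rle_refl]).
    apply (Rmult_le_reg_r (t ^ 2)); [assumption|].
    replace (INR n * - / t ^ 2 * t ^ 2) with (- INR n) by (field; lra); lra.
  - apply pow_incr; split; [left; apply exp_pos|].
    rewrite exp_Ropp.
    apply Rle_trans with (/ (1 + / t ^ 2)).
    + apply Rinv_le_contravar; [assert (0 < / t ^ 2) by (now apply Rinv_0_lt_compat); lra|].
      apply exp_ineq1_le.
    + replace (/ (1 + / t ^ 2)) with ((t / S) ^ 2).
      * assert (0 <= t / S <= 1); [|nra].
        split; [apply Rdiv_le_0_compat; lra|].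
        apply (Rmult_le_reg_r S); [lra|]; unfold Rdiv; rewrite Rmult_assoc, Rinv_l; lra.
      * unfold Rdiv; rewrite Rpow_mult_distr, pow_inv, HS2; field; split; nra.
Qed.

(** The three factors bound the power of the sine, the sine of the turning angle, and the power of
    the cosine; the last uses [2 * a <= 4 * (k + 1) * sqrt n]. *)
Definition lower_const (k : nat) : R :=
  exp (- (1)) * sin (/ 17) / (4 * (INR k + 1)) ^ k.

Lemma lower_const_pos (k : nat) : 0 < lower_const k.
Proof.
  unfold lower_const; apply Rdiv_lt_0_compat.
  - apply Rmult_lt_0_compat; [apply exp_pos|].
    apply sin_gt_0; [lra|]; generalize PI2_1; lra.
  - apply pow_lt; generalize (pos_INR k); lra.
Qed.

(* For [a <= j < 2 a] with [a] of order [sqrt (n + k)], the argument of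
   [power_mult n k] turns between [j] and [j + 1] by an angle between 1/17 and 1. *)
Lemma partial_var_power_ge (n k : nat) : (1 <= n)%nat ->
  exists N, lower_const k * (sqrt (INR n) * / sqrt (INR n) ^ k)
    <= partial_var (power_mult n k) N.
Proof.
  intros Hn; set (a := S (Nat.sqrt (n + k))).
  exists (a + a)%nat.
  assert (Hn1 : 1 <= INR n) by (apply (le_INR 1); assumption).
  assert (Hk := pos_INR k).
  set (s := sqrt (INR n)).
  assert (Hs2 : s ^ 2 = INR n) by (apply pow2_sqrt; lra).
  assert (Hs : 1 <= s) by (unfold s; rewrite <- sqrt_1; apply sqrt_le_1; lra).
  destruct (Nat.sqrt_spec' (n + k)) as [Ha1 Ha2]; fold a in Ha2.
  (* Together with [Ha2], this places [a ^ 2] between [n + k] and [4 * (n + k)]. *)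
  assert (Ha3 : (a * a <= 4 * (n + k))%nat) by (unfold a; nia).
  apply Nat.lt_le_incl, le_INR in Ha2; apply le_INR in Ha3.
  rewrite !mult_INR in Ha3; rewrite mult_INR in Ha2.
  set (M := INR (n + k)) in *; set (A := INR a) in *.
  assert (HM : M = INR n + INR k) by apply plus_INR.
  replace (INR 4) with 4 in Ha3 by (simpl; lra).
  assert (HA0 : 0 <= A) by apply pos_INR.
  assert (HA1 : s <= A) by nra.
  assert (HA2 : A <= 2 * (INR k + 1) * s).
  { apply Rsqr_incr_0_var; [|nra]; unfold Rsqr.
    replace (2 * (INR k + 1) * s * (2 * (INR k + 1) * s))
      with (4 * ((INR k + 1) ^ 2 * s ^ 2)) by ring.
    rewrite Hs2; nra. }
  assert (Hsin : 0 < sin (/ 17)).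
  { apply sin_gt_0; [lra|]; generalize PI2_1; lra. }
  assert (He := exp_pos (- (1))).
  set (c := exp (- (1)) * sin (/ 17)).
  assert (Hc : 0 < c) by now apply Rmult_lt_0_compat.
  assert (HAk : 0 < (2 * A) ^ k) by (apply pow_lt; lra).
  apply Rle_trans with (A * (c / (2 * A) ^ k)).
  - unfold lower_const; fold c.
    apply Rle_trans with (s * (c / (4 * (INR k + 1) * s) ^ k)).
    + right; rewrite (Rpow_mult_distr (4 * (INR k + 1)) s); field.
      split; apply pow_nonzero; lra.
    + apply Rmult_le_compat; [lra| |assumption|].
      * apply Rdiv_le_0_compat; [lra|apply pow_lt; nra].
      * apply Rmult_le_compat_l; [lra|]; apply Rinv_le_contravar; [assumption|].
        apply pow_incr; lra.
  - apply partial_var_ge_sum; intros j [Hj1 Hj2].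
    eapply Rle_trans; [|apply power_mult_increment_ge]; fold M.
    apply le_INR in Hj1; fold A in Hj1.
    assert (HSj : INR (S j) <= 2 * A)
      by (unfold A; rewrite <- (mult_INR 2); apply le_INR; lia).
    assert (EJ : INR (S j) = INR j + 1) by apply S_INR.
    assert (Hsn : exp (- (1)) <= sin (atan (INR j)) ^ n) by (apply sin_atan_pow_ge; nra).
    assert (Hcs : / (2 * A) ^ k <= cos (atan (INR j)) ^ k).
    { rewrite <- pow_inv; apply pow_incr; split; [left; apply Rinv_0_lt_compat; lra|].
      rewrite cos_atan; unfold Rdiv; rewrite Rmult_1_l.
      apply Rinv_le_contravar; [apply sqrt_1_sqr_pos|].
      rewrite <- (sqrt_pow2 (2 * A)) by lra; apply sqrt_le_1_alt; unfold Rsqr; nra. }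
    destruct (atan_minus_bounds (INR j) (INR (S j)) ltac:(lra)) as [HL HU].
    replace (INR (S j) - INR j) with 1 in HL, HU by lra.
    set (delta := atan (INR (S j)) - atan (INR j)) in *.
    (* From [M <= a ^ 2 <= j ^ 2]; the angle stays where the sine is increasing. *)
    assert (HM1 : M * delta <= 1).
    { apply (Rmult_le_reg_r (1 + INR j ^ 2)); [nra|].
      apply (Rmult_le_compat_l M) in HU; [|lra].
      apply (Rmult_le_compat_r (1 + INR j ^ 2)) in HU; [|nra].
      replace (M * (1 / (1 + INR j ^ 2)) * (1 + INR j ^ 2)) with M in HU by (field; nra).
      nra. }
    (* The 17 comes from [1 + (j + 1) ^ 2 <= 1 + 4 * a ^ 2 <= 1 + 16 * M <= 17 * M]. *)
    assert (HM2 : / 17 <= M * delta).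
    { apply Rle_trans with (M * (1 / (1 + INR (S j) ^ 2)));
        [|apply Rmult_le_compat_l; lra].
      apply (Rmult_le_reg_r (1 + INR (S j) ^ 2)); [nra|].
      replace (M * (1 / (1 + INR (S j) ^ 2)) * (1 + INR (S j) ^ 2)) with M by (field; nra).
      nra. }
    assert (HsM : sin (/ 17) <= sin (M * delta))
      by (assert (HP := PI2_1); apply sin_incr_1; lra).
    assert (HAi : 0 < / (2 * A) ^ k) by now apply Rinv_0_lt_compat.
    unfold c; replace (exp (- (1)) * sin (/ 17) / (2 * A) ^ k)
      with (exp (- (1)) * / (2 * A) ^ k * sin (/ 17)) by (unfold Rdiv; ring).
    apply Rmult_le_compat; [nra|lra| |assumption].
    apply Rmult_le_compat; lra.
Qed.

(** * From the multiplier sequences to the norms of the operators *)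

Lemma Rpower_half_minus (x : R) (k : nat) : 0 < x ->
  Rpower x ((1 - INR k) / 2) = sqrt x * / sqrt x ^ k.
Proof.
  intros Hx; assert (Hs : 0 < sqrt x) by now apply sqrt_lt_R0.
  replace ((1 - INR k) / 2) with (/ 2 + - (/ 2 * INR k)) by field.
  rewrite Rpower_plus, Rpower_Ropp, <- Rpower_mult, Rpower_sqrt by assumption.
  now rewrite Rpower_pow.
Qed.

(** The sequence is the image of the constant 1 under the operator itself; this covers [n = 0],
    which [partial_var_power_le] excludes. *)
Lemma bounded_var_power (n k : nat) : bounded_var (power_mult n k).
Proof.
  replace (power_mult n k)
    with (bv_seq (op_comp (op_pow (mult_op lam_bv) n) (op_pow (id_minus (mult_op lam_bv)) k)
      (bv_const 1))); [apply bv_bounded|].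
  apply functional_extensionality; intros j; unfold op_comp.
  rewrite op_pow_mult_op, op_pow_id_minus_mult_op; unfold power_mult; simpl; ring.
Qed.

Lemma op_norm_power (n k : nat) :
  let m := Bv _ (bounded_var_power n k) in
  bv_norm m
    <= op_norm (op_comp (op_pow (mult_op lam_bv) n) (op_pow (id_minus (mult_op lam_bv)) k))
    <= 2 * bv_norm m.
Proof.
  intros m; apply op_norm_mult_op; intros f; apply bv_ext; intros j; unfold op_comp.
  rewrite op_pow_mult_op, op_pow_id_minus_mult_op; simpl; unfold power_mult; ring.
Qed.

Theorem proposition3p5 :
  exists (X : CompleteNormedModule C_AbsRing) (T : X -> X),
    is_linear T /\ kreiss_bounded T /\ two_Ritt T /\
    forall k : nat, exists K : R, 1 < K /\
      forall n : nat, (1 <= n)%nat ->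
        / K * Rpower (INR n) ((1 - INR k) / 2)
          <= op_norm (op_comp (op_pow T n) (op_pow (id_minus T) k)) /\
        op_norm (op_comp (op_pow T n) (op_pow (id_minus T) k))
          <= K * Rpower (INR n) ((1 - INR k) / 2).
Proof.
  exists bv_CompleteNormedModule, (mult_op lam_bv).
  split; [apply mult_op_linear|]; split; [exact kreiss_bounded_lam|].
  split; [exact two_Ritt_lam|]; intros k.
  assert (HL := lower_const_pos k); assert (HU := upper_const_ge_0 k); assert (HP := PI_RGT_0).
  assert (HL1 : 0 < / lower_const k) by now apply Rinv_0_lt_compat.
  assert (HU1 : 0 <= upper_const k * PI) by nra.
  (* The summands give [1 < K], the lower bound, and the upper bound; the 2 is the loss in
     [op_norm_power]. *)
  set (K := 1 + / lower_const k + 2 * (upper_const k * PI)).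
  exists K; split; [unfold K; lra|]; intros n Hn.
  assert (Hn1 : 1 <= INR n) by (apply (le_INR 1); assumption).
  rewrite Rpower_half_minus by lra.
  assert (Hs : 0 < sqrt (INR n)) by (apply sqrt_lt_R0; lra).
  assert (Hg : 0 < sqrt (INR n) * / sqrt (INR n) ^ k)
    by (apply Rmult_lt_0_compat; [assumption|apply Rinv_0_lt_compat, pow_lt, Hs]).
  destruct (op_norm_power n k) as [H1 H2]; split.
  - eapply Rle_trans; [|exact H1].
    destruct (partial_var_power_ge n k Hn) as [N HN].
    eapply Rle_trans; [|apply (partial_var_le_norm _ N)].
    eapply Rle_trans; [|exact HN]; apply Rmult_le_compat_r; [lra|].
    rewrite <- (Rinv_inv (lower_const k)); apply Rinv_le_contravar; [assumption|unfold K; lra].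
  - eapply Rle_trans; [exact H2|].
    apply Rle_trans with (2 * (upper_const k * PI * (sqrt (INR n) * / sqrt (INR n) ^ k))).
    + apply Rmult_le_compat_l; [lra|]; apply bv_norm_le; intros N.
      now apply partial_var_power_le.
    + rewrite <- Rmult_assoc; apply Rmult_le_compat_r; [lra|unfold K; lra].
Qed.
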